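(* Let $q$ be a positive power of a prime and let $f\in\mathbb{F}_q[X]$ be a planar polynomial over $\mathbb{F}_q$. Then $$V(f) \le q - \frac{2(q-1)}{1+\sqrt{4q-3}}.$$
   Context: $\mathbb{F}_q$ is the finite field of $q$ elements and $\mathbb{F}_q^\ast$ its set of non-zero elements. A polynomial in $\mathbb{F}_q[X]$ is regarded as a function $\mathbb{F}_q\to\mathbb{F}_q$ by evaluation, and $V(f)=|f(\mathbb{F}_q)|$ is the number of its distinct values. A polynomial $g\in\mathbb{F}_q[X]$ is a permutation polynomial over $\mathbb{F}_q$ if $V(g)=q$. A polynomial $f\in\mathbb{F}_q[X]$ is planar over $\mathbb{F}_q$ if, for every $a\in\mathbb{F}_q^\ast$, the polynomial $\Delta_{f,a}(X)=f(X+a)-f(X)$ is a permutation polynomial over $\mathbb{F}_q$. *)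

(* Defs.v *)
From HB Require Import structures.
From mathcomp Require Import all_boot all_order all_algebra all_field.

Set Implicit Arguments.
Unset Strict Implicit.
Unset Printing Implicit Defensive.

Import Order.TTheory GRing.Theory Num.Theory.
Local Open Scope ring_scope.

Definition value_count (F : finFieldType) (f : {poly F}) : nat :=
  #|[set f.[x] | x : F]|.

Definition permutation_poly (F : finFieldType) (g : {poly F}) : Prop :=
  value_count g = #|F|.

Definition delta_poly (F : finFieldType) (f : {poly F}) (a : F) : {poly F} :=
  f \Po ('X + a%:P) - f.

Definition planar_poly (F : finFieldType) (f : {poly F}) : Prop :=
  forall a : F, a != 0 -> permutation_poly (delta_poly f a).

(* Main.v *)
Require Import Defs.
From HB Require Import structures.
From mathcomp Require Import all_boot all_order all_algebra all_field.
From mathcomp Require Import lra.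

Set Implicit Arguments.
Unset Strict Implicit.
Unset Printing Implicit Defensive.

Import Order.TTheory GRing.Theory Num.Theory.
Local Open Scope ring_scope.

(** Let [c v] be the size of the fibre of [f] over [v]. For each nonzero [a],
planarity gives exactly one [x] with [f (x + a) = f x], so there are [q - 1]
ordered pairs of distinct points with equal values; sorted by the common
value, this reads [\sum_v c v * (c v - 1) = q - 1] ([planar_collisions]).
Each single term of this sum is therefore at most [q - 1], and solving the
quadratic inequality [c * (c - 1) <= q - 1] bounds every fibre by
[T = (1 + sqrt (4 q - 3)) / 2] ([fiber_bound]). On the other hand [q - V f] is
the total excess [\sum_v (c v - 1)] over the nonempty fibres
([sum_fiber_excess]). Replacing the factor [c v] by its bound [T] in the
collision count gives [q - 1 <= T * (q - V f)], which is the claim. *)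

Definition fiber_card (aT rT : finType) (h : aT -> rT) (v : rT) : nat :=
  #|[set x | h x == v]|.

Lemma sum_fiber_weight (aT rT : finType) (h : aT -> rT) (w : rT -> nat) :
  (\sum_x w (h x) = \sum_v fiber_card h v * w v)%N.
Proof.
rewrite (partition_big h predT) //=; apply: eq_bigr => v _.
rewrite (eq_bigr (fun=> w v)) => [|x /eqP -> //].
rewrite sum_nat_const; congr (_ * _)%N.
by apply: eq_card => x; rewrite !inE.
Qed.

(** Truncated predecessor makes empty fibres contribute nothing, so the excess
can be summed over the whole codomain. *)
Lemma sum_fiber_excess (aT rT : finType) (h : aT -> rT) :
  (\sum_v (fiber_card h v).-1 + #|[set h x | x : aT]| = #|aT|)%N.
Proof.
have -> : #|aT| = (\sum_v fiber_card h v)%N.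
  rewrite -sum1_card (sum_fiber_weight h (fun=> 1%N)).
  by apply: eq_bigr => v _; rewrite muln1.
rewrite -sum1_card [X in (_ + X)%N]big_mkcond -big_split /=; apply: eq_bigr => v _.
case: imsetP => [[x _ def_v]|no_x].
  by rewrite addn1 prednK //; apply/card_gt0P; exists x; rewrite inE def_v.
suff -> : fiber_card h v = 0%N by [].
apply: eq_card0 => x; rewrite !inE; apply/negP => /eqP hx.
by case: no_x; exists x.
Qed.

(** A self-map of a finite set that takes every value is a bijection, so the
difference polynomial vanishes exactly once. *)
Lemma planar_unique_collision (F : finFieldType) (f : {poly F}) (a : F) :
  planar_poly f -> a != 0 -> #|[set x | f.[x + a] == f.[x]]| = 1%N.
Proof.
move=> hf a0; have hE x : (delta_poly f a).[x] = f.[x + a] - f.[x].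
  by rewrite /delta_poly hornerD hornerN horner_comp !hornerE.
have inj : injective (fun x => (delta_poly f a).[x]).
  by apply: in2T; apply/imset_injP; apply/eqP; apply: hf.
have [g _ gK] := injF_bij inj; have g0 : (delta_poly f a).[g 0] = 0 := gK 0.
apply/eqP/cards1P; exists (g 0); apply/setP=> x.
by rewrite !inE -subr_eq0 -hE -[RHS](inj_eq inj) g0.
Qed.

Lemma planar_collisions (F : finFieldType) (f : {poly F}) :
  planar_poly f ->
  (\sum_v fiber_card (horner f) v * (fiber_card (horner f) v).-1 = #|F|.-1)%N.
Proof.
move=> hf; rewrite -sum_fiber_weight.
(* The points sharing the value of [x], other than [x] itself, are
   parametrised by their nonzero translation [a] from [x]. *)
have others x : (fiber_card (horner f) f.[x]).-1
    = (\sum_(a | a != 0%R) (f.[x + a] == f.[x]))%N.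
  rewrite /fiber_card (cardsD1 x) inE eqxx /= -sum1_card.
  rewrite (reindex_inj (addrI x)) /= big_mkcond [RHS]big_mkcond /=.
  apply: eq_bigr => a _; rewrite !inE -{2}[x]addr0 (inj_eq (addrI x)).
  by case: (a != 0); case: eqP.
rewrite (eq_bigr _ (fun x _ => others x)) exchange_big /=.
rewrite (eq_bigr (fun=> 1%N)) => [|a a0]; last first.
  rewrite -(planar_unique_collision hf a0) -sum1_card [RHS]big_mkcond /=.
  by apply: eq_bigr => x _; rewrite inE; case: eqP.
rewrite sum1_card -(cardC1 (0 : F)).
by apply: eq_card => a; rewrite !inE.
Qed.

(** Completing the square: the hypothesis says [(2 c - 1)^2 <= 4 q - 3]. *)
Lemma fiber_bound (R : rcfType) (c q : nat) :
  (0 < q)%N -> (c * c.-1 <= q.-1)%N ->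
  c%:R <= (1 + Num.sqrt (4 * q%:R - 3)) / 2 :> R.
Proof.
case: q => // q _; case: c => [|c] /= hc.
  by have := sqrtr_ge0 (4 * q.+1%:R - 3 : R); lra.
have {}hc : (c%:R + 1) * c%:R <= q%:R :> R by rewrite natr1 -natrM ler_nat.
have c0 : 0 <= c%:R :> R by rewrite ler0n.
suff : 2 * c%:R + 1 <= Num.sqrt (4 * q.+1%:R - 3) :> R.
  by rewrite -[c.+1%:R]natr1; lra.
rewrite -[leLHS]ger0_norm -?sqrtr_sqr; last by lra.
by apply: ler_wsqrtr; rewrite -[q.+1%:R]natr1; nra.
Qed.

Theorem mainTheorem4 (R : rcfType) (F : finFieldType) (q : nat)
    (hq : #|F| = q) (f : {poly F}) (hf : planar_poly f) :
  (value_count f)%:R <=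
    q%:R - 2 * (q%:R - 1) / (1 + Num.sqrt (4 * q%:R - 3)) :> R.
Proof.
set s := Num.sqrt _.
have s0 : 0 <= s by apply: sqrtr_ge0.
have q0 : (0 < q)%N by rewrite -hq; apply/card_gt0P; exists 0.
pose c := fiber_card (horner f).
have coll : (\sum_v c v * (c v).-1 = q.-1)%N by rewrite planar_collisions ?hq.
have excess : (\sum_v (c v).-1)%:R + (value_count f)%:R = q%:R :> R.
  by rewrite -natrD sum_fiber_excess hq.
have key : q%:R - 1 <= (1 + s) / 2 * (\sum_v (c v).-1)%:R.
  have -> : q%:R - 1 = (\sum_v c v * (c v).-1)%:R :> R.
    by rewrite coll -subn1 natrB.
  rewrite !natr_sum mulr_sumr; apply: ler_sum => v _.
  rewrite natrM ler_wpM2r ?ler0n //; apply: fiber_bound => //.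
  by rewrite -coll (bigD1 v) //= leq_addr.
have s1 : 0 < 1 + s by lra.
suff : 2 * (q%:R - 1) / (1 + s) <= (\sum_v (c v).-1)%:R by lra.
by rewrite ler_pdivrMr //; lra.
Qed.
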